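(* Fix a binary instance $(\mu_0,\hat q)$. There exist a constant $c>0$ and a horizon $T_0$, depending only on $(\mu_0,\hat q)$, such that for every $T\ge T_0$ and every (possibly randomized) sender policy $\Pi$, $$\sup_{\alpha^\star\in[0,1]}\mathrm{Reg}_T(\Pi;\alpha^\star)\ge c\log\log T.$$
   Context: Binary model: states $\Omega=\{0,1\}$, actions $A=\{0,1\}$, prior $\mu_0=\Pr(\omega=1)\in(0,1)$, cutoff $\hat q\in(\mu_0,1)$, sender utility $u_S(a,\omega)=\mathbf 1\{a=1\}$. A receiver with fixed bias $\alpha^\star\in[0,1]$, unknown to the sender, takes action $1$ after Bayesian posterior $\nu=\Pr(\omega=1\mid s)$ iff $(1-\alpha^\star)\mu_0+\alpha^\star\nu\ge\hat q$. Over $T$ rounds, in each round $t$: - The sender commits to a Bayes-plausible distribution over posteriors (finitely supported on $[0,1]$ with mean $\mu_0$), chosen as a possibly randomized function of the history. - A state $\omega_t\sim\mu_0$ and a posterior $\nu_t$ are realized consistently with the committed distribution. - The receiver acts, and the sender observes the scheme, $\omega_t$, $\nu_t$ and the action. A sender policy $\Pi$ may depend on $(\mu_0,\hat q)$ and $T$ but not on $\alpha^\star$. Let $\mathrm{OPT}(\alpha^\star)$ be the supremum over Bayes-plausible distributions of the probability of inducing action $1$. The regret is $\mathrm{Reg}_T(\Pi;\alpha^\star)=T\cdot\mathrm{OPT}(\alpha^\star)-\sum_t\mathbb E[\Pr(\text{action }1\text{ in round }t\mid\text{history})]$. *)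

(* Defs.v *)
From HB Require Import structures.
From mathcomp Require Import all_boot all_order all_algebra.
From mathcomp Require Import all_classical all_reals all_analysis.
Set Implicit Arguments. Unset Strict Implicit. Unset Printing Implicit Defensive.
Import Order.TTheory GRing.Theory Num.Theory.
Local Open Scope ring_scope.

Section Persuasion.
Variables (R : realType) (mu0 qhat : R).

(* A Bayes-plausible signaling scheme: a finitely supported distribution over
   posteriors, given as a list of (probability, posterior) pairs with
   nonnegative weights summing to 1, posteriors in [0,1], and mean mu0. *)
Record scheme := Scheme {
  supp : seq (R * R);
  supp_ok : [&& all (fun pv => (0 <= pv.1) && (0 <= pv.2 <= 1)) supp,
                \sum_(pv <- supp) pv.1 == 1
              & \sum_(pv <- supp) pv.1 * pv.2 == mu0] }.

Definition act (alpha nu : R) : bool := qhat <= (1 - alpha) * mu0 + alpha * nu.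

Definition prob1 (alpha : R) (sigma : scheme) : R :=
  \sum_(pv <- supp sigma) pv.1 * (act alpha pv.2)%:R.

Definition OPT (alpha : R) : R := sup (range (prob1 alpha)).

(* One round of history observed by the sender:
   (committed scheme, state omega (true = 1), realized posterior, action). *)
Definition round := (scheme * bool * R * bool)%type.
Definition history := seq round.   (* chronological order *)

Definition policy := history -> scheme.

(* Expected number of rounds with action 1 over n remaining rounds, starting
   from history h, when the receiver has bias alpha.  A round realises posterior
   nu_i with state 1 w.p. p_i nu_i and state 0 w.p. p_i (1 - nu_i). *)
Fixpoint payoff_from (Pi : policy) (alpha : R) (n : nat) (h : history) : R :=
  match n with
  | 0 => 0
  | n'.+1 =>
    let sigma := Pi h in
    \sum_(pv <- supp sigma) \sum_(w : bool)
      (if w then pv.1 * pv.2 else pv.1 * (1 - pv.2)) *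
      ((act alpha pv.2)%:R +
       payoff_from Pi alpha n' (rcons h (sigma, w, pv.2, act alpha pv.2)))
  end.

Definition payoff (Pi : policy) (alpha : R) (T : nat) : R :=
  payoff_from Pi alpha T [::].

(* Regret of a randomized policy: the randomization is an internal seed s drawn
   from a probability space (S, P), and Pi s is a deterministic policy. *)
Definition regret (d : measure_display) (S : measurableType d)
  (P : probability S R) (Pi : S -> policy) (T : nat) (alpha : R) : \bar R :=
  ((T%:R * OPT alpha)%:E - \int[P]_s (payoff (Pi s) alpha T)%:E)%E.

End Persuasion.

(* Main.v *)
(* A bias is encoded by its acceptance threshold [theta] for the posterior, and
   [OPT >= mu0 / theta].  As posteriors average to [mu0], a round's regret is the
   mean of [nu / theta - 1{nu >= theta}]: a posterior just below the threshold
   costs a constant, one above it costs the overshoot.  By averaging (Yao), it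
   suffices to bound the mean regret of a deterministic policy when [theta] is
   uniform on a grid of [T] points in [[qhat, 1]].  The feedback then only cuts a
   block of consecutive thresholds in two, and by induction on the number [n] of
   remaining rounds the mean regret on a block of relative length [1 / y] is at
   least [c (lnln (n + y) - lnln y)], up to a discretization error of [O(n / T)],
   where [lnln y] stands for [ln (1 + ln y)]. *)
Require Import Defs.
From HB Require Import structures.
From mathcomp Require Import all_boot all_order all_algebra.
From mathcomp Require Import all_classical all_reals all_analysis.
From mathcomp Require Import ring lra.
Set Implicit Arguments. Unset Strict Implicit. Unset Printing Implicit Defensive.
Import Order.TTheory GRing.Theory Num.Theory.
Local Open Scope ring_scope.
Local Open Scope classical_set_scope.

(** * Tangent bounds for the logarithm and the iterated-logarithm potential *)

Lemma lnB_le (R : realType) (x y : R) :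
  0 < x -> 0 < y -> ln y - ln x <= (y - x) / x.
Proof.
move=> x0 y0; rewrite -ln_div ?posrE//.
have -> : y / x = 1 + (y - x) / x by field; rewrite gt_eqF.
apply: le_ln1Dx.
have -> : (y - x) / x = y / x - 1 by field; rewrite gt_eqF.
by rewrite ltrBrDl subrr divr_gt0.
Qed.

(** Multiplying the tangent bound by [k] makes it valid at [k = 0] too, which covers an empty part
    of a split block. *)
Lemma mul_lnB_le (R : realType) (k z : R) :
  0 <= k -> 0 < z -> k * (ln z - ln k) <= z - k.
Proof.
move=> k0 z0; have [->|kn0] := eqVneq k 0; first by rewrite mul0r subr0 ltW.
have kp : 0 < k by rewrite lt_def kn0.
apply: le_trans (ler_wpM2l k0 (lnB_le kp z0)) _.
by rewrite mulrC divfK.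
Qed.

(** The shift by 1 gives the value 0 at [y = 1], that is for the full grid, and keeps the outer
    logarithm nonnegative for [y >= 1]. *)
Definition lnln {R : realType} (y : R) : R := ln (1 + ln y).

Lemma lnlnB_le (R : realType) (x y : R) : 1 <= x -> x <= y ->
  lnln y - lnln x <= (ln y - ln x) / (1 + ln x).
Proof.
move=> x1 xy; have := ln_ge0 x1; have : ln x <= ln y by rewrite ler_ln ?posrE; lra.
move=> lxy lx0; rewrite /lnln.
apply: le_trans (lnB_le _ _) _; [lra|lra|].
by have -> : 1 + ln y - (1 + ln x) = ln y - ln x by ring.
Qed.

Lemma lnln_le (R : realType) (x y : R) : 1 <= x -> x <= y -> lnln x <= lnln y.
Proof.
move=> x1 xy; have := ln_ge0 x1.
have : ln x <= ln y by rewrite ler_ln ?posrE; lra.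
by rewrite /lnln => *; rewrite ler_ln ?posrE; lra.
Qed.

Definition potential {R : realType} (c : R) (n : nat) (y : R) : R :=
  c * (lnln (n%:R + y) - lnln y).

Lemma potential0 (R : realType) (c y : R) : potential c 0 y = 0.
Proof. by rewrite /potential add0r subrr mulr0. Qed.

(** The derivative of [lnln] beyond [y] is at most [1 / y]. On a block of [m] thresholds among [N],
    one more round thus asks for at most [c m^2 / N] in total. *)
Lemma potentialS (R : realType) (c : R) (n : nat) (y : R) : 0 <= c -> 1 <= y ->
  potential c n.+1 y <= potential c n y + c / y.
Proof.
move=> c0 y1; rewrite /potential -mulrDr ler_wpM2l//.
have n0 : 0 <= n%:R :> R by [].
rewrite -natr1; set z := _ + y.
suff : lnln z - lnln (n%:R + y) <= y^-1 by lra.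
have l0 : 0 <= ln (n%:R + y) by apply: ln_ge0; lra.
apply: le_trans (lnlnB_le _ _) _; [lra|rewrite /z; lra|].
have zB : ln z - ln (n%:R + y) <= y^-1.
  apply: le_trans (lnB_le _ _) _; [lra|rewrite /z; lra|].
  have -> : z - (n%:R + y) = 1 by rewrite /z; ring.
  by rewrite mul1r lef_pV2 ?posrE; lra.
rewrite ler_pdivrMr; last lra.
apply: le_trans zB _; rewrite ler_peMr ?invr_ge0; lra.
Qed.

(** Since [lnln (n + y)] grows with [y], only the subtracted term can lose, so the bound is uniform
    in [n]. *)
Lemma potential_decr (R : realType) (c : R) (n : nat) (x y : R) :
  0 <= c -> 1 <= x -> x <= y ->
  potential c n x - potential c n y <= c * ((ln y - ln x) / (1 + ln x)).
Proof.
move=> c0 x1 xy; rewrite /potential -mulrBr ler_wpM2l//.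
have n0 : 0 <= n%:R :> R by [].
have := lnlnB_le x1 xy.
have : lnln (n%:R + x) <= lnln (n%:R + y) by apply: lnln_le; lra.
lra.
Qed.

(* The entropy bounds [k ln (m/k) <= j] and [j ln (m/j) <= j ln (N/m) + m^2/N]
   make the loss of potential linear in [j], the size of the upper part. *)
Lemma potential_split (R : realType) (c : R) (n k j m N : nat) :
  0 <= c -> m = (k + j)%N -> (0 < m <= N)%N ->
  m%:R * potential c n (N%:R / m%:R) <=
  k%:R * potential c n (N%:R / k%:R) + j%:R * potential c n (N%:R / j%:R)
  + c * (2 * j%:R + m%:R ^+ 2 / N%:R).
Proof.
move=> c0 mkj /andP[m0 mN].
have mp : 0 < m%:R :> R by rewrite ltr0n.
have Np : 0 < N%:R :> R by rewrite ltr0n (leq_trans m0).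
have mNR : m%:R <= N%:R :> R by rewrite ler_nat.
have l0 : 0 <= ln (N%:R / m%:R : R) by apply: ln_ge0; rewrite ler_pdivlMr // mul1r.
have part (i : nat) : (i <= m)%N ->
  i%:R * (potential c n (N%:R / m%:R) - potential c n (N%:R / i%:R)) <=
  c * (i%:R * (ln m%:R - ln i%:R) / (1 + ln (N%:R / m%:R))).
  move=> im; have [->|i0] := posnP i; first by rewrite !mul0r mulr0.
  have ip : 0 < i%:R :> R by rewrite ltr0n.
  have imR : i%:R <= m%:R :> R by rewrite ler_nat.
  rewrite -mulrA [leRHS]mulrCA ler_wpM2l//.
  apply: le_trans (potential_decr _ c0 _ _) _.
  - by rewrite ler_pdivlMr // mul1r.
  - by rewrite ler_wpM2l ?lef_pV2 // ltW.
  - suff -> : ln (N%:R / i%:R) - ln (N%:R / m%:R) = ln m%:R - ln i%:R :> R by [].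
    by rewrite !ln_div ?posrE //; ring.
have Hk : (k <= m)%N by rewrite mkj leq_addr.
have Hj : (j <= m)%N by rewrite mkj leq_addl.
move/part: Hk => Hk; move/part: Hj => Hj.
have mE : m%:R = k%:R + j%:R :> R by rewrite mkj natrD.
have k0 : 0 <= k%:R :> R by []. have j0 : 0 <= j%:R :> R by [].
have Ek : k%:R * (ln m%:R - ln k%:R) / (1 + ln (N%:R / m%:R)) <= j%:R :> R.
  rewrite ler_pdivrMr; last lra.
  apply: le_trans (mul_lnB_le k0 mp) _.
  by rewrite mE addrC addKr ler_peMr//; rewrite -mE; lra.
have Ej : j%:R * (ln m%:R - ln j%:R) / (1 + ln (N%:R / m%:R)) <= j%:R + m%:R ^+ 2 / N%:R :> R.
  (* The tangent bound is taken at [m^2 / N], which turns [ln (m / j)] into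
     [ln (m / j) - ln (N / m)]. The missing [j ln (N / m)] is absorbed by the denominator
     [1 + ln (N / m)]. *)
  have z0 : 0 < m%:R ^+ 2 / N%:R :> R by rewrite divr_gt0 // exprn_gt0.
  rewrite ler_pdivrMr; last lra.
  have := mul_lnB_le j0 z0.
  rewrite !ln_div ?posrE ?exprn_gt0 // lnXn // in l0 *.
  nra.
have := ler_wpM2l c0 Ek; have := ler_wpM2l c0 Ej.
rewrite [X in X * potential c n (N%:R / m%:R)]mE; nra.
Qed.

(** * The model in terms of acceptance thresholds *)

(** Solution [alpha] of [(1 - alpha) mu0 + alpha theta = qhat]. *)
Definition bias {R : realType} (mu0 qhat theta : R) : R :=
  (qhat - mu0) / (theta - mu0).

Lemma act_bias (R : realType) (mu0 qhat theta nu : R) :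
  mu0 < qhat -> qhat <= theta ->
  act mu0 qhat (bias mu0 qhat theta) nu = (theta <= nu).
Proof.
move=> mq qt; rewrite /act /bias; set a := _ / _.
have -> : (1 - a) * mu0 + a * nu = mu0 + a * (nu - mu0) by ring.
have tm : 0 < theta - mu0 by lra.
rewrite -subr_ge0 -[RHS]subr_ge0.
have -> : mu0 + a * (nu - mu0) - qhat = (qhat - mu0) * (nu - theta) / (theta - mu0).
  by rewrite /a; field; lra.
by rewrite pmulr_lge0 ?invr_gt0// pmulr_rge0//; lra.
Qed.

Lemma bias_itv (R : realType) (mu0 qhat theta : R) :
  mu0 < qhat -> qhat <= theta -> 0 <= bias mu0 qhat theta <= 1.
Proof.
move=> mq qt; rewrite /bias ler_pdivrMr ?divr_ge0; lra.
Qed.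

Lemma suppP (R : realType) (mu0 : R) (sigma : scheme mu0) :
  [/\ forall pv, pv \in supp sigma -> 0 <= pv.1 /\ 0 <= pv.2 <= 1,
      \sum_(pv <- supp sigma) pv.1 = 1
    & \sum_(pv <- supp sigma) pv.1 * pv.2 = mu0].
Proof.
have /and3P[/allP h /eqP h1 /eqP h2] := supp_ok sigma.
by split=> // pv /h /andP.
Qed.

Lemma prob1_le1 (R : realType) (mu0 qhat alpha : R) (sigma : scheme mu0) :
  prob1 qhat alpha sigma <= 1.
Proof.
have [pos <- _] := suppP sigma; rewrite /prob1 big_seq [leRHS]big_seq.
apply: ler_sum => pv /pos[p0 _]; rewrite ler_piMr//.
by case: act.
Qed.

(** The witness puts mass [mu0 / theta] exactly at the threshold and the rest on posterior 0. The
    real [sup] is a genuine supremum because probabilities are bounded by 1. *)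
Lemma OPT_bias_ge (R : realType) (mu0 qhat theta : R) :
  0 < mu0 -> mu0 < qhat -> qhat <= theta <= 1 ->
  mu0 / theta <= OPT mu0 qhat (bias mu0 qhat theta).
Proof.
move=> m0 mq /andP[qt t1]; have t0 : 0 < theta by lra.
have mt : mu0 / theta <= 1 by rewrite ler_pdivrMr; lra.
have mt0 : 0 <= mu0 / theta by rewrite divr_ge0; lra.
pose s := [:: (mu0 / theta, theta); (1 - mu0 / theta, 0)].
have ok : [&& all (fun pv : R * R => (0 <= pv.1) && (0 <= pv.2 <= 1)) s,
    \sum_(pv <- s) pv.1 == 1 & \sum_(pv <- s) pv.1 * pv.2 == mu0].
  apply/and3P; split; rewrite /s.
  - by rewrite /= mt0 t1 !lexx ler01 subr_ge0 mt (ltW t0).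
  - by rewrite !big_cons big_nil /=; apply/eqP; ring.
  - by rewrite !big_cons big_nil /=; apply/eqP; field; lra.
have -> : mu0 / theta = prob1 qhat (bias mu0 qhat theta) (Scheme ok).
  rewrite /prob1 /= !big_cons big_nil /= !act_bias// lexx.
  by rewrite leNgt t0 /= mulr1 mulr0 !addr0.
apply: ub_le_sup; last by exists (Scheme ok).
by exists 1 => _ [sigma _ <-]; exact: prob1_le1.
Qed.

Lemma payoff_from_itv (R : realType) (mu0 qhat : R) (Pi : policy mu0)
    (alpha : R) (n : nat) (h : history mu0) :
  0 <= payoff_from qhat Pi alpha n h <= n%:R.
Proof.
elim: n h => [|n IH] h /=; first by rewrite lexx.
have [pos sum1 _] := suppP (Pi h).
have term pv : pv \in supp (Pi h) ->
  0 <= \sum_(w : bool) (if w then pv.1 * pv.2 else pv.1 * (1 - pv.2)) *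
    ((act mu0 qhat alpha pv.2)%:R + payoff_from qhat Pi alpha n
      (rcons h (Pi h, w, pv.2, act mu0 qhat alpha pv.2))) <= pv.1 * n.+1%:R.
  move=> /pos[p0 /andP[v0 v1]]; rewrite big_bool /= -natr1.
  have := IH (rcons h (Pi h, true, pv.2, act mu0 qhat alpha pv.2)).
  have := IH (rcons h (Pi h, false, pv.2, act mu0 qhat alpha pv.2)).
  have : 0 <= ((act mu0 qhat alpha pv.2)%:R : R) <= 1 by case: act; rewrite /= ?lexx ?ler01.
  move: (payoff_from _ _ _ _ _) (payoff_from _ _ _ _ _) (_%:R) => x y a.
  move=> /andP[a0 a1] /andP[x0 x1] /andP[y0 y1].
  have q0 : 0 <= pv.1 * pv.2 by rewrite mulr_ge0.
  have q1 : 0 <= pv.1 * (1 - pv.2) by rewrite mulr_ge0// subr_ge0.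
  apply/andP; split; first by rewrite addr_ge0// mulr_ge0// addr_ge0.
  have -> : pv.1 * (n%:R + 1) = pv.1 * pv.2 * (n%:R + 1) + pv.1 * (1 - pv.2) * (n%:R + 1) by ring.
  by apply: lerD; rewrite ler_wpM2l//; lra.
apply/andP; split; first by rewrite big_seq sumr_ge0// => pv /term /andP[].
have -> : n.+1%:R = \sum_(pv <- supp (Pi h)) pv.1 * n.+1%:R :> R.
  by rewrite -mulr_suml sum1 mul1r.
rewrite big_seq [leRHS]big_seq.
by apply: ler_sum => pv /term /andP[].
Qed.

(** By Bayes plausibility an affine function of the posterior averages to its value at [mu0]; the
    slope [B] acts as a multiplier for the mean constraint. The bound is the same for both states,
    whose weights add up to [pv.1]. *)
Lemma scheme_mean_ge (R : realType) (mu0 A B : R) (sigma : scheme mu0)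
    (F : R * R -> bool -> R) :
  (forall pv w, pv \in supp sigma -> 0 <= pv.2 <= 1 -> A + B * pv.2 <= F pv w) ->
  A + B * mu0 <= \sum_(pv <- supp sigma) \sum_(w : bool)
     (if w then pv.1 * pv.2 else pv.1 * (1 - pv.2)) * F pv w.
Proof.
move=> AF; have [pos sum1 mean] := suppP sigma.
have -> : A + B * mu0 = \sum_(pv <- supp sigma) pv.1 * (A + B * pv.2).
  rewrite -[LHS]/(A + B * mu0) -[in LHS]mean -[X in X + _]mulr1 -[in X in X + _]sum1.
  rewrite !mulr_sumr -big_split /=.
  by apply: eq_bigr => pv _; ring.
rewrite big_seq [leRHS]big_seq; apply: ler_sum => pv pvin.
have [p0 v01] := pos _ pvin; have /andP[v0 v1] := v01.
rewrite big_bool /=.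
have -> : pv.1 * (A + B * pv.2) =
  pv.1 * pv.2 * (A + B * pv.2) + pv.1 * (1 - pv.2) * (A + B * pv.2) by ring.
by apply: lerD; apply: ler_wpM2l; rewrite ?AF// mulr_ge0// subr_ge0.
Qed.

(** Regret with [OPT] replaced by its lower bound [mu0 / theta], which yields an exact recursion
    over rounds. *)
Definition excess {R : realType} {mu0 : R} (qhat : R) (Pi : policy mu0)
    (theta : R) (n : nat) (h : history mu0) : R :=
  n%:R * (mu0 / theta) - payoff_from qhat Pi (bias mu0 qhat theta) n h.

(* Since posteriors average to [mu0], the optimum [mu0 / theta] can be charged
   posterior by posterior: [nu] costs [nu / theta - 1{nu >= theta}]. *)
Lemma excessS (R : realType) (mu0 qhat : R) (Pi : policy mu0) (theta : R)
    (n : nat) (h : history mu0) : mu0 < qhat -> qhat <= theta ->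
  excess qhat Pi theta n.+1 h =
  \sum_(pv <- supp (Pi h)) \sum_(w : bool)
    (if w then pv.1 * pv.2 else pv.1 * (1 - pv.2)) *
    (pv.2 / theta - (theta <= pv.2)%R%:R +
     excess qhat Pi theta n (rcons h (Pi h, w, pv.2, theta <= pv.2))).
Proof.
move=> mq qt; have [_ sum1 mean] := suppP (Pi h).
rewrite /excess /= -natr1 mulrDl mul1r.
have -> : n%:R * (mu0 / theta) + mu0 / theta =
  \sum_(pv <- supp (Pi h)) (pv.1 * (n%:R * (mu0 / theta)) + pv.1 * pv.2 / theta).
  by rewrite big_split /= -!mulr_suml sum1 mean mul1r.
rewrite -sumrB; apply: eq_bigr => pv _.
by rewrite act_bias// !big_bool /=; ring.
Qed.

(** * The grid of thresholds and the cost of one posterior on a block *)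

Lemma antitone_prefix (P : nat -> bool) (m : nat) :
  (forall i j, (i <= j)%N -> P j -> P i) ->
  exists k, (k <= m)%N /\ forall i, (i < m)%N -> P i = (i < k)%N.
Proof.
move=> Pdec; elim: m => [|m [k [km kP]]]; first by exists 0%N.
have [Pm|nPm] := boolP (P m).
  by exists m.+1; split=> // i im; rewrite im (Pdec i m).
exists k; split=> [|i]; first exact: leqW.
rewrite ltnS leq_eqVlt => /predU1P[->|]; last exact: kP.
by rewrite (negbTE nPm) ltnNge km.
Qed.

Lemma sum_arith (R : realType) (b s : R) (k : nat) :
  \sum_(i < k) (b - s * i%:R) = k%:R * b - s * (k%:R ^+ 2 - k%:R) / 2.
Proof.
elim: k => [|k IH]; first by rewrite big_ord0; field.
by rewrite big_ord_recr /= IH -natr1; field.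
Qed.

Definition grid {R : realType} (qhat : R) (N i : nat) : R :=
  qhat + (1 - qhat) / N%:R * i%:R.

Lemma grid_itv (R : realType) (qhat : R) (N i : nat) :
  qhat < 1 -> (i < N)%N -> qhat <= grid qhat N i <= 1.
Proof.
move=> q1 iN; have Np : 0 < N%:R :> R by rewrite ltr0n (leq_ltn_trans _ iN).
have iNR : i%:R <= N%:R :> R by rewrite ler_nat ltnW.
have w0 : 0 <= (1 - qhat) / N%:R by rewrite divr_ge0; lra.
rewrite /grid; have := ler_wpM2l w0 iNR; rewrite divfK ?gt_eqF//.
have : 0 <= (1 - qhat) / N%:R * i%:R by rewrite mulr_ge0.
lra.
Qed.

Lemma grid_homo (R : realType) (qhat : R) (N i j : nat) :
  qhat < 1 -> (i <= j)%N -> grid qhat N i <= grid qhat N j.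
Proof.
move=> q1 ij; rewrite /grid lerD2l ler_wpM2l ?ler_nat // divr_ge0 ?ler0n //; lra.
Qed.

(** The posterior exceeds the [i]-th threshold by at least [k - 1 - i] grid steps, hence
    [k (k - 1) / 2] steps in total. Dividing by thresholds at most 1 only increases the cost. *)
Lemma overshoot_cost (R : realType) (qhat nu : R) (N lo k : nat) :
  0 < qhat < 1 -> (lo + k <= N)%N -> (0 < k)%N ->
  grid qhat N (lo + k.-1) <= nu ->
  (1 - qhat) / (2 * N%:R) * (k%:R ^+ 2 - k%:R) <=
  \sum_(i < k) (nu / grid qhat N (lo + i) - 1).
Proof.
case: k => // k /andP[q0 q1] loN _ /= kn.
have Np : 0 < N%:R :> R by rewrite ltr0n (leq_trans _ loN)// addnS.
pose s : R := (1 - qhat) / N%:R.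
apply: (@le_trans _ _ (\sum_(i < k.+1) (nu - grid qhat N lo - s * i%:R))).
  rewrite sum_arith.
  have : s * k%:R <= nu - grid qhat N lo.
    by move: kn; rewrite /grid -/s natrD; lra.
  move=> /(ler_wpM2l (ler0n R k.+1)).
  have -> : (1 - qhat) / (2 * N%:R) = s / 2 by rewrite /s; field; lra.
  rewrite -natr1; nra.
apply: ler_sum => i _.
have iN : (lo + i < N)%N by rewrite (leq_trans _ loN)// ltn_add2l.
have /andP[g0 g1] := grid_itv q1 iN.
have gi : grid qhat N (lo + i) <= nu.
  by apply: le_trans kn; rewrite grid_homo// leq_add2l -ltnS.
have -> : nu - grid qhat N lo - s * i%:R = nu - grid qhat N (lo + i).
  by rewrite /grid -/s natrD; ring.
have -> : nu / grid qhat N (lo + i) - 1 = (nu - grid qhat N (lo + i)) / grid qhat N (lo + i).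
  by field; lra.
by rewrite ler_pdivlMr; last lra; nra.
Qed.

Lemma undershoot_cost (R : realType) (qhat nu : R) (N lo j : nat) :
  0 < qhat < 1 -> 0 <= nu -> (lo + j <= N)%N ->
  j%:R * nu <= \sum_(i < j) nu / grid qhat N (lo + i).
Proof.
move=> /andP[q0 q1] nu0 loN.
rewrite mulr_natl -[j in leLHS]card_ord -sumr_const; apply: ler_sum => i _.
have iN : (lo + i < N)%N by rewrite (leq_trans _ loN)// ltn_add2l.
have /andP[g0 g1] := grid_itv q1 iN.
by rewrite ler_pdivlMr; [nra|lra].
Qed.

(* The error [(1 - qhat) / (2 N)] per threshold is unavoidable on a grid: a block
   reduced to a single threshold can be queried without loss. *)
Lemma split_cost (R : realType) (mu0 qhat c nu S : R) (n N m k j : nat) :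
  0 < mu0 < 1 -> 0 < qhat < 1 -> c = mu0 * (1 - qhat) * qhat / 8 ->
  0 <= nu <= 1 -> (0 < m <= N)%N -> m = (k + j)%N ->
  ((0 < k)%N -> qhat <= nu) ->
  (if (0 < k)%N then (1 - qhat) / (2 * N%:R) * (k%:R ^+ 2 - k%:R) else 0)
    + j%:R * nu <= S ->
  m%:R * potential c n (N%:R / m%:R) - m%:R * ((1 - qhat) / (2 * N%:R))
    + (c * m%:R ^+ 2 / N%:R / mu0) * nu <=
  S + k%:R * potential c n (N%:R / k%:R) + j%:R * potential c n (N%:R / j%:R).
Proof.
move=> /andP[m0 m1] /andP[q0 q1] cE /andP[nu0 nu1] mN mkj kq HS.
have /andP[mgt0 mleN] := mN.
have mp : 0 < m%:R :> R by rewrite ltr0n.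
have Np : 0 < N%:R :> R by rewrite ltr0n (leq_trans mgt0).
have mNR : m%:R <= N%:R :> R by rewrite ler_nat.
have cm : c / mu0 = (1 - qhat) * qhat / 8 by rewrite cE; field; lra.
have c0 : 0 <= c by rewrite cE !mulr_ge0//; lra.
pose z : R := m%:R ^+ 2 / N%:R.
have zm : z <= m%:R by rewrite /z ler_pdivrMr// expr2 ler_wpM2l.
have z0 : 0 <= z by rewrite divr_ge0// sqr_ge0.
have -> : c * m%:R ^+ 2 / N%:R / mu0 = (1 - qhat) * qhat / 8 * z.
  by rewrite -cm /z; field; lra.
have sl0 : 0 <= m%:R * ((1 - qhat) / (2 * N%:R)) by rewrite mulr_ge0// divr_ge0; lra.
have wq : (1 - qhat) * qhat / 8 <= 1 / 8 by nra.
(* If every threshold rejects, the block stays whole and [nu] may be tiny; the cost [m nu] still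
   pays, because the amount due is proportional to [nu]. *)
have [k0|kp] := posnP k.
  have jm : j = m by rewrite mkj k0.
  move: HS; rewrite k0 jm /= mul0r add0r => HS.
  have : (1 - qhat) * qhat / 8 * z * nu <= m%:R * nu by rewrite ler_wpM2r//; nra.
  lra.
rewrite kp in HS; have {}kq := kq kp.
have := potential_split n c0 mkj mN; rewrite -/z.
have kR : 0 <= k%:R :> R by []. have jR : 0 <= j%:R :> R by [].
have jN : j%:R <= N%:R :> R by rewrite ler_nat (leq_trans _ mleN)// mkj leq_addl.
have kmR : k%:R <= m%:R :> R by rewrite ler_nat mkj leq_addr.
pose x : R := k%:R ^+ 2 / N%:R.
have zx : z <= 2 * x + 2 * j%:R.
  have jj : j%:R ^+ 2 / N%:R <= j%:R :> R by rewrite ler_pdivrMr// expr2 ler_wpM2l.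
  have -> : z = 2 * x + 2 * (j%:R ^+ 2 / N%:R) - (k%:R - j%:R) ^+ 2 / N%:R.
    by rewrite /z /x mkj natrD; field; lra.
  have : 0 <= (k%:R - j%:R) ^+ 2 / N%:R :> R by rewrite divr_ge0// sqr_ge0.
  lra.
have x0 : 0 <= x by rewrite divr_ge0// sqr_ge0.
have HS' : (1 - qhat) / 2 * x - m%:R * ((1 - qhat) / (2 * N%:R)) + j%:R * qhat <= S.
  apply: le_trans HS.
  have -> : (1 - qhat) / (2 * N%:R) * (k%:R ^+ 2 - k%:R) =
    (1 - qhat) / 2 * x - k%:R * ((1 - qhat) / (2 * N%:R)) by rewrite /x; field; lra.
  have : k%:R * ((1 - qhat) / (2 * N%:R)) <= m%:R * ((1 - qhat) / (2 * N%:R)).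
    by rewrite ler_wpM2r// divr_ge0; lra.
  have := ler_wpM2l jR kq; lra.
(* With [w = c / mu0], the left side is at most [w (2 j + 2 z)], hence at most [w (4 x + 6 j)]. The
   8 in [c] makes [4 w <= (1 - qhat) / 2], paid by the overshoot, and [6 w <= qhat], paid by the
   undershoot. *)
suff : c * (2 * j%:R + z) + (1 - qhat) * qhat / 8 * z * nu <=
    (1 - qhat) / 2 * x + j%:R * qhat by lra.
pose w : R := (1 - qhat) * qhat / 8.
have w0 : 0 <= w by rewrite /w divr_ge0// mulr_ge0; lra.
have cw : c <= w.
  have -> : c = mu0 * w by rewrite cE /w; ring.
  by rewrite ler_piMl // ltW.
have wnu : w * z * nu <= w * z by rewrite ler_piMr// mulr_ge0.
have wz := ler_wpM2l w0 zx.
have cz : c * (2 * j%:R + z) <= w * (2 * j%:R + z) by rewrite ler_wpM2r//; lra.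
have wx : w * (4 * x) <= (1 - qhat) / 2 * x.
  have -> : w * (4 * x) = (1 - qhat) / 2 * x * qhat by rewrite /w; field.
  by apply: ler_piMr; [rewrite mulr_ge0 // divr_ge0; lra|lra].
have wj : w * (6 * j%:R) <= j%:R * qhat.
  have -> : w * (6 * j%:R) = j%:R * qhat * (3 / 4 * (1 - qhat)) by rewrite /w; field.
  by rewrite ler_piMr ?mulr_ge0 //; lra.
rewrite -/w; lra.
Qed.

(** * Induction on the number of remaining rounds *)

(** Block and history are arbitrary, as the induction applies to both parts of a split. The
    discretization error is linear in [m], so it adds up over the parts; for an empty part the
    factor [m] cancels the default value of [N / 0]. *)
Lemma sum_excess_ge (R : realType) (mu0 qhat c : R) (Pi : policy mu0)
    (n N lo m : nat) (h : history mu0) :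
  0 < mu0 < 1 -> mu0 < qhat < 1 -> c = mu0 * (1 - qhat) * qhat / 8 ->
  (lo + m <= N)%N ->
  m%:R * potential c n (N%:R / m%:R) - n%:R * (m%:R * ((1 - qhat) / (2 * N%:R)))
  <= \sum_(i < m) excess qhat Pi (grid qhat N (lo + i)) n h.
Proof.
move=> mu01 /andP[muq q1] cE; have /andP[mu0p mu1] := mu01.
have q01 : 0 < qhat < 1 by lra.
have c0 : 0 <= c by rewrite cE divr_ge0 // !mulr_ge0; lra.
elim: n lo m h => [|n IH] lo m h loN.
  rewrite potential0 mulr0 mul0r subrr sumr_ge0// => i _.
  by rewrite /excess mul0r /= subrr.
have [->|mp] := posnP m; first by rewrite big_ord0 !mul0r mulr0 subrr.
have mN : (0 < m <= N)%N by rewrite mp (leq_trans (leq_addl _ _) loN).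
have mR : 0 < m%:R :> R by rewrite ltr0n.
have NR : 0 < N%:R :> R by rewrite ltr0n (leq_trans mp) // (leq_trans (leq_addl _ _) loN).
have gI i : (i < m)%N -> qhat <= grid qhat N (lo + i) <= 1.
  by move=> im; rewrite grid_itv // (leq_trans _ loN) // ltn_add2l.
pose e : R := m%:R * ((1 - qhat) / (2 * N%:R)).
pose r : R := c * m%:R ^+ 2 / N%:R.
rewrite -/e.
have tS : m%:R * potential c n.+1 (N%:R / m%:R) <=
    m%:R * potential c n (N%:R / m%:R) + r.
  have := @potentialS _ c n (N%:R / m%:R) c0 _.
  rewrite ler_pdivlMr // mul1r ler_nat (andP mN).2 => /(_ isT).
  move=> /(ler_wpM2l (ltW mR)) /le_trans; apply.
  rewrite mulrDr lerD2l /r le_eqVlt; apply/orP; left; apply/eqP; field; lra.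
(* The increase [r] is charged as [(r / mu0) nu], with mean [r]: a constant charge would fail at
   posterior 0, which costs nothing. *)
apply: (@le_trans _ _
  ((m%:R * potential c n (N%:R / m%:R) - e - n%:R * e) + r / mu0 * mu0)).
  by rewrite divfK ?gt_eqF// -natr1 mulrDl mul1r; lra.
under eq_bigr => i _ do rewrite excessS ?(andP (gI i (ltn_ord i))).1 //.
(* All thresholds of the block share the history [h], hence the scheme [Pi h], so their sum can be
   moved inside. *)
rewrite exchange_big /=.
under eq_bigr => pv _ do rewrite exchange_big /=.
under eq_bigr => pv _ do under eq_bigr => w _ do rewrite -mulr_sumr.
apply: (@scheme_mean_ge _ _ _ _ (Pi h)
  (fun pv w => \sum_(i < m) (pv.2 / grid qhat N (lo + i) -
     (grid qhat N (lo + i) <= pv.2)%R%:R + excess qhat Pi (grid qhat N (lo + i)) n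
        (rcons h (Pi h, w, pv.2, grid qhat N (lo + i) <= pv.2))))).
move=> [p nu] w _ /= nu01.
have [k [km kP]] : exists k, (k <= m)%N /\
    forall i, (i < m)%N -> (grid qhat N (lo + i) <= nu) = (i < k)%N.
  apply: (@antitone_prefix (fun i => grid qhat N (lo + i) <= nu)) => i j ij.
  by apply: le_trans; rewrite grid_homo // leq_add2l.
pose j := (m - k)%N; have mkj : m = (k + j)%N by rewrite subnKC.
have knu : (0 < k)%N -> grid qhat N (lo + k.-1) <= nu.
  by move=> kp; rewrite kP ?prednK // (leq_trans _ km) // prednK.
have kq : (0 < k)%N -> qhat <= nu.
  move=> kp; apply: le_trans (knu kp).
  by have /andP[] : qhat <= grid qhat N (lo + k.-1) <= 1 by rewrite gI// prednK.
clearbody j.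
pose h' b := rcons h (Pi h, w, nu, b).
(* Accepting thresholds continue with [h' true] and rejecting ones with [h' false]: two consecutive
   blocks, starting at [lo] and [lo + k]. *)
have -> : \sum_(i < m) (nu / grid qhat N (lo + i) -
     (grid qhat N (lo + i) <= nu)%R%:R + excess qhat Pi (grid qhat N (lo + i)) n
        (rcons h (Pi h, w, nu, grid qhat N (lo + i) <= nu))) =
  \sum_(i < k) (nu / grid qhat N (lo + i) - 1) +
  \sum_(i < j) nu / grid qhat N (lo + k + i) +
  \sum_(i < k) excess qhat Pi (grid qhat N (lo + i)) n (h' true) +
  \sum_(i < j) excess qhat Pi (grid qhat N (lo + k + i)) n (h' false).
  pose F (i : nat) := nu / grid qhat N (lo + i) -
     (grid qhat N (lo + i) <= nu)%R%:R + excess qhat Pi (grid qhat N (lo + i)) n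
        (rcons h (Pi h, w, nu, grid qhat N (lo + i) <= nu)).
  have -> : \sum_(i < m) F i = \sum_(i < k) F i + \sum_(i < j) F (k + i)%N.
    by rewrite mkj big_split_ord.
  rewrite -[RHS]addrA [RHS]addrACA -!big_split /=; congr (_ + _).
    apply: eq_bigr => i _; rewrite /F kP ?ltn_ord //.
    by rewrite (leq_trans (ltn_ord i)).
  apply: eq_bigr => i _; have mki : (k + i < m)%N by rewrite mkj ltn_add2l.
  have := kP _ mki; rewrite /F addnA => ->.
  by rewrite ltnNge leq_addr /= subr0.
have lok : (lo + k <= N)%N by rewrite (leq_trans _ loN)// leq_add2l.
have loj : (lo + k + j <= N)%N by rewrite -addnA -mkj.
have IHk := IH lo k (h' true) lok; have IHj := IH (lo + k)%N j (h' false) loj.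
have /andP[nu0 nu1] := nu01.
have Ck : (if (0 < k)%N then (1 - qhat) / (2 * N%:R) * (k%:R ^+ 2 - k%:R) else 0)
    <= \sum_(i < k) (nu / grid qhat N (lo + i) - 1).
  case: ifP => kp; first by apply: overshoot_cost; rewrite ?knu.
  by move/negbT: kp; rewrite -eqn0Ngt => /eqP->; rewrite big_ord0.
have Cj := undershoot_cost q01 nu0 loj.
have := split_cost n mu01 q01 cE nu01 mN mkj kq (lerD Ck Cj).
rewrite -/e -/r; have -> : n%:R * e = n%:R * (k%:R * ((1 - qhat) / (2 * N%:R))) + n%:R * (j%:R * ((1 - qhat) / (2 * N%:R))).
  by rewrite /e mkj natrD; ring.
lra.
Qed.

(** * Averaging over the seed and conclusion *)

(** The bound on the mean over indices holds for each seed and so survives integration. The index is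
    chosen only afterwards, so a single bias serves the whole randomized policy. *)
Lemma exists_integral_le (R : realType) d (S : measurableType d)
    (P : probability S R) (N : nat) (a : nat -> R) (g : nat -> S -> R) (B M : R) :
  (0 < N)%N -> (forall i, measurable_fun setT (g i)) ->
  (forall i s, `|g i s| <= B) ->
  (forall s, N%:R * M <= \sum_(i < N) (a i - g i s)) ->
  exists2 i, (i < N)%N & (M%:E <= (a i)%:E - \int[P]_s (g i s)%:E)%E.
Proof.
move=> N0 mg gB HM.
have ig i : P.-integrable setT (EFin \o g i).
  apply: measurable_bounded_integrable => //=.
    exact: fin_num_fun_lty.
  exists B; split; first exact: num_real.
  by move=> x Bx s _ /=; apply: le_trans (gB i s) _; exact: ltW.
apply: contrapT => no.
have lt i : (i < N)%N -> a i - (\int[P]_s g i s)%R < M.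
  move=> iN; rewrite ltNge; apply/negP => Mle; apply: no; exists i => //.
  by rewrite /Rintegral in Mle; rewrite -(fineK (integrable_fin_num measurableT (ig i))) -EFinB lee_fin.
have sumlt : \sum_(i < N) (a i - (\int[P]_s g i s)%R) < N%:R * M.
  rewrite mulr_natl -[N in ltRHS]card_ord -sumr_const.
  apply: ltr_sum => [|i _]; last exact: lt.
  by apply/hasP; exists (Ordinal N0); rewrite ?mem_index_enum.
suff : N%:R * M <= \sum_(i < N) (a i - (\int[P]_s g i s)%R) by rewrite leNgt sumlt.
rewrite sumrB.
have -> : \sum_(i < N) (\int[P]_s g i s)%R = (\int[P]_s (\sum_(i < N) g i s))%R.
  rewrite /Rintegral; under [in RHS]eq_integral => s _ do rewrite -sumEFin.
  rewrite (integral_sum measurableT (f := fun i : 'I_N => EFin \o g i)) //.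
  by rewrite sum_fine // => i _; exact: integrable_fin_num (ig i).
have isum : P.-integrable setT (EFin \o (fun s => \sum_(i < N) g i s)).
  have -> : EFin \o (fun s => \sum_(i < N) g i s) = (fun s => \sum_(i < N) (EFin \o g i) s)%E.
    by apply/funext => s /=; rewrite sumEFin.
  exact: integrable_sum.
have : (\int[P]_s (\sum_(i < N) g i s) <= \int[P]_s (\sum_(i < N) a i - N%:R * M))%R.
  apply: le_Rintegral => //.
    by apply: finite_measure_integrable_cst.
  by move=> s _; have := HM s; rewrite sumrB; lra.
have PT : fine (P [set: S]) = 1 by have -> := probability_setT P.
by rewrite Rintegral_cst// PT mulr1; lra.
Qed.

Unset Implicit Arguments. Set Strict Implicit.

Theorem theorem3p3 (R : realType) (mu0 qhat : R) :
  0 < mu0 < 1 -> mu0 < qhat < 1 ->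
  exists c : R, 0 < c /\ exists T0 : nat,
    forall T : nat, (T0 <= T)%N ->
    forall (d : measure_display) (S : measurableType d) (P : probability S R)
           (Pi : S -> policy mu0),
      (forall alpha : R,
         measurable_fun setT (fun s => payoff qhat (Pi s) alpha T)) ->
      ((c * ln (ln T%:R))%:E <=
       ereal_sup [set regret qhat P Pi T alpha | alpha in `[0%R, 1%R]])%E.
Proof.
move=> mu01 muq1; have /andP[mu0p mu1] := mu01; have /andP[muq q1] := muq1.
pose c : R := mu0 * (1 - qhat) * qhat / 8.
have c0 : 0 < c by rewrite divr_gt0 // !mulr_gt0; lra.
exists (c / 2); split; first by rewrite divr_gt0.
(* This horizon ensures [c ln (ln T) >= 1], so that half of [c ln (ln T)] absorbs the discretization
   error [(1 - qhat) / 2]. *)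
exists (Num.trunc (expR (expR c^-1))).+1 => T TT d S P Pi mPi.
have ET : expR (expR c^-1) <= T%:R.
  by rewrite ltW // (lt_le_trans (truncnS_gt _)) // ler_nat.
have T0 : 0 < T%:R :> R by apply: lt_le_trans ET; rewrite expR_gt0.
have lT : expR c^-1 <= ln T%:R by rewrite -[leLHS]expRK ler_ln ?posrE ?expR_gt0.
have lT0 : 0 < ln T%:R :> R by apply: lt_le_trans lT; rewrite expR_gt0.
have llT : c^-1 <= ln (ln T%:R) by rewrite -[leLHS]expRK ler_ln ?posrE ?expR_gt0.
have Tn : (0 < T)%N by rewrite -(ltr0n R).
have grow : ln (ln T%:R) <= lnln (T%:R + 1) :> R.
  rewrite /lnln; have : ln T%:R <= ln (T%:R + 1) :> R by rewrite ler_ln ?posrE; lra.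
  by move=> ?; rewrite ler_ln ?posrE; lra.
have cll : 1 <= c * ln (ln T%:R) by rewrite mulrC -ler_pdivrMr // mul1r.
pose g i s := if (i < T)%N
  then payoff qhat (Pi s) (bias mu0 qhat (grid qhat T i)) T else 0.
have mg i : measurable_fun setT (g i).
  by rewrite /g; case: (i < T)%N => //; exact: measurable_cst.
have gT i s : `|g i s| <= T%:R.
  rewrite /g; case: ifP => _; last by rewrite normr0.
  have /andP[p0 p1] := payoff_from_itv qhat (Pi s) (bias mu0 qhat (grid qhat T i)) T [::].
  by rewrite ger0_norm.
have avg s : T%:R * (c / 2 * ln (ln T%:R)) <=
    \sum_(i < T) (T%:R * (mu0 / grid qhat T i) - g i s).
  (* With as many grid points as rounds, the error accumulated per threshold stays bounded; the full
     block has [y = 1], where [lnln] vanishes. *)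
  have := @sum_excess_ge R mu0 qhat c (Pi s) T T 0 T [::] mu01 muq1 erefl (leqnn T).
  rewrite divff ?gt_eqF // /potential {2}/lnln ln1 addr0 ln1 subr0 => H.
  under eq_bigr => i _ do rewrite /g ltn_ord.
  apply: le_trans H; rewrite -mulrBr ler_wpM2l //.
  have -> : T%:R * ((1 - qhat) / (2 * T%:R)) = (1 - qhat) / 2 by field; lra.
  have := ler_wpM2l (ltW c0) grow.
  lra.
have [i iT Hi] := exists_integral_le P
  (a := fun i => T%:R * (mu0 / grid qhat T i)) Tn mg gT avg.
move: Hi; rewrite /g iT => Hi.
have giI : qhat <= grid qhat T i <= 1 by rewrite grid_itv.
have /andP[g0 _] := giI.
apply: le_trans (ereal_sup_ubound _); last first.
  exists (bias mu0 qhat (grid qhat T i)) => //=.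
  by rewrite in_itv /=; apply: bias_itv.
apply: (le_trans Hi); rewrite /regret; apply: leeB => //.
by rewrite lee_fin ler_wpM2l // OPT_bias_ge.
Qed.
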